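(* Let $(H,\circ)$ be an intra-regular hypersemigroup and let $f:H\to[0,1]$ be a fuzzy subset of $H$. Then $f$ is a fuzzy ideal of $H$ if and only if $f$ is a fuzzy interior ideal of $H$.
   Context: A hypergroupoid is a nonempty set $H$ with a map $\circ: H\times H\to \mathcal{P}^*(H)$, where $\mathcal{P}^*(H)$ is the set of nonempty subsets of $H$. For $A,B\in\mathcal{P}^*(H)$ put $A*B=\bigcup_{(a,b)\in A\times B}(a\circ b)$; thus $\{x\}*\{y\}=x\circ y$. A hypersemigroup is a hypergroupoid with $\{x\}*(y\circ z)=(x\circ y)*\{z\}$ for all $x,y,z\in H$; then $*$ is associative on $\mathcal{P}^*(H)$. A hypersemigroup $H$ is intra-regular if for every $a\in H$ there exist $x,y\in H$ such that $a\in(x\circ a)*(a\circ y)$. A fuzzy subset of $H$ is a map $f:H\to[0,1]$ (real interval). It is a fuzzy left ideal if for all $x,y\in H$ and all $u\in x\circ y$, $f(u)\ge f(y)$; a fuzzy right ideal if for all $x,y\in H$ and all $u\in x\circ y$, $f(u)\ge f(x)$; a fuzzy ideal if it is both a fuzzy left ideal and a fuzzy right ideal. It is a fuzzy interior ideal if for all $x,a,y\in H$ and all $u\in (x\circ a)*\{y\}$, $f(u)\ge f(a)$. *)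

(* Defs.v *)
From mathcomp Require Import all_boot all_order all_algebra.
From mathcomp Require Import all_classical all_reals interval_inference.

Set Implicit Arguments.
Unset Strict Implicit.
Unset Printing Implicit Defensive.

Import Order.TTheory GRing.Theory Num.Theory.
Local Open Scope classical_set_scope.
Local Open Scope ring_scope.

Record hypergroupoid := Hypergroupoid {
  carrier :> Type;
  hyperop : carrier -> carrier -> set carrier;
  carrier_nonempty : inhabited carrier;
  hyperop_nonempty : forall x y, hyperop x y !=set0
}.

Notation "x ∘ y" := (hyperop x y) (at level 40, left associativity).

(* Total on [set H]; on nonempty arguments the result is again nonempty. *)
Definition hyperprod (H : hypergroupoid) (A B : set H) : set H :=
  \bigcup_(p in A `*` B) (p.1 ∘ p.2).

Notation "A ⊛ B" := (hyperprod A B) (at level 40, left associativity).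

Definition is_hypersemigroup (H : hypergroupoid) : Prop :=
  forall x y z : H, [set x] ⊛ (y ∘ z) = (x ∘ y) ⊛ [set z].

Definition intra_regular (H : hypergroupoid) : Prop :=
  forall a : H, exists x y : H, ((x ∘ a) ⊛ (a ∘ y)) a.

(* [{i01 R}] is the type of elements of the closed interval [0, 1] of R. *)
Definition fuzzy_subset (R : realType) (H : hypergroupoid) : Type :=
  H -> {i01 R}.

Section FuzzyIdeals.
Variables (R : realType) (H : hypergroupoid).
Implicit Type f : fuzzy_subset R H.

Definition fuzzy_left_ideal f : Prop :=
  forall x y u : H, (x ∘ y) u -> (f u)%:num >= (f y)%:num.

Definition fuzzy_right_ideal f : Prop :=
  forall x y u : H, (x ∘ y) u -> (f u)%:num >= (f x)%:num.

Definition fuzzy_ideal f : Prop := fuzzy_left_ideal f /\ fuzzy_right_ideal f.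

Definition fuzzy_interior_ideal f : Prop :=
  forall x a y u : H, ((x ∘ a) ⊛ [set y]) u -> (f u)%:num >= (f a)%:num.

End FuzzyIdeals.

(* Main.v *)
Require Import Defs.
From mathcomp Require Import all_boot all_order all_algebra.
From mathcomp Require Import all_classical all_reals interval_inference.

(** A fuzzy ideal is always a fuzzy interior ideal: an element of [x a y] lies
    in [v y] for some [v] in [x a], so its value is at least that of [v] (right
    ideal), which is at least that of [a] (left ideal).

    Conversely, intra-regularity places [a] in a product [s t] with [s] in
    [p a] and [t] in [a q], so [a] lies in [(p a)(a q)]. A product of [a] with
    another element, on either side, then has each value in some triple product
    whose middle factor is one of the two copies of [a]; associativity moves
    the other copy and the new element into an outer factor, and the interior
    condition applies. *)

Local Open Scope classical_set_scope.

Lemma hyperprod_set1rP (H : hypergroupoid) (A : set H) (y u : H) :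
  (A ⊛ [set y]) u <-> exists2 v, A v & (v ∘ y) u.
Proof.
split=> [[[v z] /= [Av ->] vyu]|[v Av vyu]]; first by exists v.
by exists (v, y).
Qed.

Lemma hyperprod_set1lP (H : hypergroupoid) (x u : H) (A : set H) :
  ([set x] ⊛ A) u <-> exists2 v, A v & (x ∘ v) u.
Proof.
split=> [[[z v] /= [-> Av] xvu]|[v Av xvu]]; first by exists v.
by exists (x, v).
Qed.

(** The form in which intra-regularity is used: each of the two factors of [a]
    carries its own copy of [a], which can serve as the middle factor. *)
Lemma intra_regular_factor (H : hypergroupoid) (a : H) : intra_regular H ->
  exists p q s t : H, [/\ (p ∘ a) s, (a ∘ q) t & (s ∘ t) a].
Proof. by move=> /(_ a)[p [q [[s t] /= [pas aqt] sta]]]; exists p, q, s, t. Qed.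

Lemma fuzzy_ideal_interior (R : realType) (H : hypergroupoid)
    (f : fuzzy_subset R H) :
  fuzzy_ideal f -> fuzzy_interior_ideal f.
Proof.
move=> [fl fr] x a y u /hyperprod_set1rP[v xav vyu].
exact: Order.POrderTheory.le_trans (fl _ _ _ xav) (fr _ _ _ vyu).
Qed.

(** The copy of [a] in the second factor [t] becomes the middle one:
    [x a] is inside [x (s t) = (x s) t], and [w t] is inside [(w a) q] for every
    [w] in [x s]. *)
Lemma fuzzy_interior_left (R : realType) (H : hypergroupoid)
    (f : fuzzy_subset R H) :
  is_hypersemigroup H -> intra_regular H ->
  fuzzy_interior_ideal f -> fuzzy_left_ideal f.
Proof.
move=> assoc ireg fi x a u xau.
have [p [q [s [t [_ aqt sta]]]]] := intra_regular_factor _ a ireg.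
have : ([set x] ⊛ (s ∘ t)) u by apply/hyperprod_set1lP; exists a.
rewrite assoc => /hyperprod_set1rP[w _ wtu].
by apply: (fi w a q); rewrite -assoc; apply/hyperprod_set1lP; exists t.
Qed.

(** The copy of [a] in the first factor [s] becomes the middle one:
    [a y] is inside [(s t) y = s (t y)], and [s w] is inside [(p a) w] for every
    [w] in [t y]. *)
Lemma fuzzy_interior_right (R : realType) (H : hypergroupoid)
    (f : fuzzy_subset R H) :
  is_hypersemigroup H -> intra_regular H ->
  fuzzy_interior_ideal f -> fuzzy_right_ideal f.
Proof.
move=> assoc ireg fi a y u ayu.
have [p [q [s [t [pas _ sta]]]]] := intra_regular_factor _ a ireg.
have : ((s ∘ t) ⊛ [set y]) u by apply/hyperprod_set1rP; exists a.
rewrite -assoc => /hyperprod_set1lP[w _ swu].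
by apply: (fi p a w); apply/hyperprod_set1rP; exists s.
Qed.

Theorem theorem2p15 (R : realType) (H : hypergroupoid)
    (H_semigroup : is_hypersemigroup H) (H_intra_regular : intra_regular H)
    (f : fuzzy_subset R H) :
  fuzzy_ideal f <-> fuzzy_interior_ideal f.
Proof.
split=> [|fi]; first exact: fuzzy_ideal_interior.
by split; [exact: fuzzy_interior_left|exact: fuzzy_interior_right].
Qed.
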